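(* Let $\star$ be a nontrivial semistar operation of an integral domain $D$, let $X$ be an indeterminate over $D$, and set $N(\star) := \{h \in D[X] \mid h \neq 0 \text{ and } \boldsymbol{c}(h)^\star = D^\star\}$. Then: (1) $N(\star) = N(\star_f)$ is a saturated multiplicatively closed subset of $D[X]$. (2) $N(\star) = D[X] \setminus \bigcup\{Q[X] \mid Q \in \mathcal{M}(\star_f)\}$. (3) $\mathrm{Max}(D[X]_{N(\star)}) = \{Q[X]_{N(\star)} \mid Q \in \mathcal{M}(\star_f)\}$. (4) $D[X]_{N(\star)} = \bigcap\{D_Q(X) \mid Q \in \mathcal{M}(\star_f)\}$. (5) $\mathcal{M}(\star_f)$ coincides with the canonical image in $\mathrm{Spec}(D)$ of the maximal spectrum of $D[X]_{N(\star)}$; i.e. $\mathcal{M}(\star_f) = \{M \cap D \mid M \in \mathrm{Max}(D[X]_{N(\star)})\}$.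
   Context: $D$ is an integral domain with quotient field $K$. $\overline{\boldsymbol{F}}(D)$ is the set of nonzero $D$-submodules of $K$, and $\boldsymbol{f}(D)$ the set of nonzero finitely generated $D$-submodules of $K$. A semistar operation of $D$ is a map $\star : \overline{\boldsymbol{F}}(D) \to \overline{\boldsymbol{F}}(D)$, $E \mapsto E^\star$, such that for all $0 \neq z \in K$ and all $E, F \in \overline{\boldsymbol{F}}(D)$: $(zE)^\star = zE^\star$; $E \subseteq F \Rightarrow E^\star \subseteq F^\star$; $E \subseteq E^\star$ and $(E^\star)^\star = E^\star$. It is trivial if $E^\star = K$ for all $E$ (equivalently $D^\star = K$), and nontrivial otherwise. The associated semistar operation of finite type is $E^{\star_f} := \bigcup\{F^\star \mid F \subseteq E,\ F \in \boldsymbol{f}(D)\}$. For a semistar operation $\ast$, a quasi-$\ast$-ideal of $D$ is a nonzero ideal $I \subseteq D$ with $I^\ast \cap D = I$; a quasi-$\ast$-maximal ideal is a maximal element of the set of all proper quasi-$\ast$-ideals of $D$. $\mathcal{M}(\star_f)$ denotes the set of quasi-$\star_f$-maximal ideals of $D$ (these are prime ideals). $\boldsymbol{c}(h)$ is the content of $h \in D[X]$, the ideal of $D$ generated by its coefficients. $N(\star_f)$ is defined as $N(\star)$ with $\star_f$ in place of $\star$. For a ring $R$, the Nagata ring is $R(X) := \{f/g \mid f,g \in R[X],\ \boldsymbol{c}(g) = R\}$. $Q[X]_{N(\star)}$ is the extension of $Q[X]$ to the localization $D[X]_{N(\star)}$. *)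

(* Defs.v *)
From mathcomp Require Import all_boot all_order all_algebra.
From mathcomp Require Import fraction boolp classical_sets.

Set Implicit Arguments.
Unset Strict Implicit.
Unset Printing Implicit Defensive.

Import GRing.Theory.
Local Open Scope classical_set_scope.
Local Open Scope ring_scope.

Notation tofrac := (@FracField.tofrac _).

(* Subrings, submodules and ideals are Prop-valued subsets.  [submodule R E]
   and [ideal R I] are meant for a subring [R] of the ambient ring [T];
   [R := setT] gives the ideals of [T] itself, and the unit ideal is allowed. *)
Section Subsets.
Variable T : comNzRingType.
Implicit Types (R E I : set T) (h : {poly T}).

Definition submodule R E : Prop :=
  [/\ E 0,
      forall x y, E x -> E y -> E (x + y)
    & forall a x, R a -> E x -> E (a * x)].

Definition nonzero E : Prop := exists2 x, E x & x != 0.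

Definition ideal R I : Prop := submodule R I /\ I `<=` R.

Definition maximal_elt (A : set (set T)) (M : set T) : Prop :=
  A M /\ forall J, A J -> M `<=` J -> J = M.

Definition maxSpec R : set (set T) :=
  [set M | maximal_elt [set I | ideal R I /\ I `<` R] M].

Definition content R h : set T := smallest (ideal R) [set` (h : seq T)].

(* [polys R] is R[X] inside T[X]; it is also used for the ideal Q[X]. *)
Definition polys R : set {poly T} := [set h | h \is a polyOver (mem R)].

Definition mult_closed (S : set T) : Prop :=
  S 1 /\ forall x y, S x -> S y -> S (x * y).

Definition saturated (S : set T) : Prop :=
  forall x y, S (x * y) -> S x /\ S y.

End Subsets.

(* Inside a field [F] containing the domain [T] via [phi], the localization
   of [T] at a multiplicative set [S] not containing 0. *)
Definition localization (T : idomainType) (F : fieldType) (phi : T -> F)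
    (S : set T) : set F :=
  [set phi f / phi s | f in [set: T] & s in S].

(* The ideal of the subring [R] of [F] generated by the image of [I]. *)
Definition extension (T : idomainType) (F : fieldType) (phi : T -> F)
    (R : set F) (I : set T) : set F :=
  smallest (ideal R) (phi @` I).

(* R(X) for a subring [R] of [T], as a subset of Frac(T[X]). *)
Definition nagata (T : idomainType) (R : set T) : set {fraction {poly T}} :=
  [set tofrac f / tofrac g | f in polys R & g in
     [set g | polys R g /\ content R g = R]].

Section Semistar.
Variable D : idomainType.
Local Notation K := {fraction D}.
Implicit Types (star : set K -> set K) (E F : set K) (I Q : set D).

Definition Fbar : set (set K) :=
  [set E | submodule (range tofrac) E /\ nonzero E].

Definition fgmod : set (set K) :=
  [set F | Fbar F /\
     exists s : seq K, F = smallest (submodule (range tofrac)) [set` s]].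

Definition scale (z : K) E : set K := [set z * x | x in E].

(* A semistar operation is represented by a map on all subsets of K, of which
   only the values on [Fbar] matter. *)
Definition semistar star : Prop :=
  [/\ forall E, Fbar E -> Fbar (star E),
      forall z E, z != 0 -> Fbar E -> star (scale z E) = scale z (star E),
      forall E F, Fbar E -> Fbar F -> E `<=` F -> star E `<=` star F,
      forall E, Fbar E -> E `<=` star E
    & forall E, Fbar E -> star (star E) = star E].

Definition trivial_semistar star : Prop :=
  forall E, Fbar E -> star E = [set: K].

Definition finite_type star : set K -> set K :=
  fun E => \bigcup_(F in [set F | fgmod F /\ F `<=` E]) star F.

Definition quasi_ideal star I : Prop :=
  [/\ ideal setT I, nonzero I & tofrac @^-1` (star (tofrac @` I)) = I].

Definition quasi_maximal star : set (set D) :=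
  [set Q | maximal_elt [set I | quasi_ideal star I /\ I `<` setT] Q].

Definition Nstar star : set {poly D} :=
  [set h | h != 0 /\
     star (tofrac @` content setT h) = star (range tofrac)].

(* D[X] embedded in K(X), the ambient field of D[X]_N and of the D_Q(X). *)
Definition polyfrac (h : {poly D}) : {fraction {poly K}} :=
  tofrac (map_poly tofrac h).

Definition localring Q : set K := localization tofrac (~` Q).

Definition DXN star : set {fraction {poly K}} :=
  localization polyfrac (Nstar star).

Definition QXN star Q : set {fraction {poly K}} :=
  extension polyfrac (DXN star) (polys Q).

Definition contract (M : set {fraction {poly K}}) : set D :=
  [set d | M (polyfrac d%:P)].

End Semistar.

(* Main.v *)
From HB Require Import structures.
From mathcomp Require Import all_boot all_order all_algebra.
From mathcomp Require Import fraction boolp classical_sets.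
Require Import Defs.

Set Implicit Arguments.
Unset Strict Implicit.
Unset Printing Implicit Defensive.

Import GRing.Theory.
Local Open Scope classical_set_scope.
Local Open Scope ring_scope.

(** Write st for the finite type operation attached to the given one.  Since
    the content of a nonzero polynomial is finitely generated, the two
    operations have the same set N ([Nstar_finite_type]), and st is again a
    semistar operation ([finite_type_semistar]).  So everything can be proved
    for a nontrivial semistar operation of finite character, meaning that each
    element of the closure of E lies in the closure of a finitely generated
    submodule of E.

    Finite character makes Zorn's lemma applicable to proper quasi-ideals: an
    ideal I whose closure does not contain 1 lies in a quasi-maximal ideal
    ([quasi_maximal_above]), and quasi-maximal ideals are prime
    ([quasi_maximal_prime]).  A nonzero h is in N exactly when 1 lies in the
    closure of its content ([Nstar_unit]), so h in N cannot have all its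
    coefficients in a quasi-maximal Q, whose closure meets D only in Q.

    The heart of the proof is [disjoint_ideal_sub]: every ideal J of D[X]
    disjoint from N is contained in Q[X] for some quasi-maximal Q.  For f and g
    in J, the polynomial f + X^n g with n large is in J, and its content
    contains those of f and g.  Hence the contents of the members of J form a
    directed family; if 1 were in the closure of their union, finite character
    would put 1 in the closure of the content of a single h in J, that is, h
    would be in N.  So the union lies in some quasi-maximal Q, and J in Q[X].

    The rest follows from this.  Applied to the ideal generated by a single h
    not in N, it shows that N is the complement of the union of the Q[X]; these
    being prime, N is multiplicatively closed and saturated.  A proper ideal of
    D[X]_N contracts to an ideal of D[X] disjoint from N, so it lies in Q[X]_N
    for some quasi-maximal Q; as Q[X]_N contracts to Q, distinct quasi-maximal
    ideals have incomparable extensions, so the Q[X]_N are exactly the maximal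
    ideals, and their contractions to D are the quasi-maximal ideals.  Finally,
    let z be in every D_Q(X) and let J be the ideal of the h in D[X] with h z
    in D[X].  Clearing denominators shows that J is contained in no Q[X]
    ([nagata_denominator]), so J meets N, and z is a fraction with denominator
    in N. *)

(** * Directed families and submodules *)

Definition directed (I T : Type) (P : set I) (F : I -> set T) : Prop :=
  P !=set0 /\ forall i j, P i -> P j -> exists2 k, P k & F i `|` F j `<=` F k.

Lemma directed_chain (T : Type) (C : set (set T)) :
  C !=set0 -> total_on C subset -> directed C id.
Proof.
move=> C0 Ctot; split=> // X Y CX CY.
have [XY|YX] := Ctot X Y CX CY; [exists Y|exists X] => //;
  by rewrite subUset; split.
Qed.

(** This turns finite generation into a containment: a submodule generated by
    finitely many elements of a directed union of submodules lies in one of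
    them. *)
Lemma directed_seq (I : Type) (T : eqType) (P : set I) (F : I -> set T)
    (s : seq T) :
  directed P F -> [set` s] `<=` \bigcup_(i in P) F i ->
  exists2 i, P i & [set` s] `<=` F i.
Proof.
move=> [[i0 Pi0] dir]; elim: s => [_|x s IHs sub]; first by exists i0.
have [|i Pi si] := IHs.
  by move=> y ys; apply: sub; rewrite /= inE (ys : y \in s) orbT.
have [|j Pj Fjx] := sub x; first by rewrite /= mem_head.
have [k Pk ijk] := dir i j Pi Pj; exists k => // y.
rewrite /= inE => /orP[/eqP ->|ys]; apply: ijk; first by right.
by left; apply: si.
Qed.

Section Submodules.
Variable T : comNzRingType.
Implicit Types (R E I : set T).

Lemma smallest_submodule R (A : set T) :
  submodule R (smallest (submodule R) A).
Proof.
split=> [E [[]] //|x y Ax Ay E EA|a x Ra Ax E EA].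
- by have [[_ ED _] _] := EA; apply: ED; [apply: Ax|apply: Ay].
- by have [[_ _ EM] _] := EA; apply: EM => //; apply: Ax.
Qed.

Lemma bigcup_submodule (I : Type) (P : set I) (F : I -> set T) R :
  directed P F -> (forall i, P i -> submodule R (F i)) ->
  submodule R (\bigcup_(i in P) F i).
Proof.
move=> [[i0 Pi0] dir] subF; split.
- by exists i0 => //; have [] := subF _ Pi0.
- move=> x y [i Pi Fx] [j Pj Fy]; have [k Pk ijk] := dir i j Pi Pj.
  exists k => //; have [_ FD _] := subF _ Pk.
  by apply: FD; apply: ijk; [left|right].
- move=> a x Ra [i Pi Fx]; exists i => //.
  by have [_ _ FM] := subF _ Pi; apply: FM.
Qed.

Lemma ideal_setT I : ideal setT I <-> submodule setT I.
Proof. by split=> [[]|]. Qed.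

Lemma contentE (h : {poly T}) :
  content setT h = smallest (submodule setT) [set` (h : seq T)].
Proof.
rewrite /content; suff -> : @ideal T setT = submodule setT by [].
apply: funext => I. apply: propext. exact: ideal_setT.
Qed.

Lemma ideal_one R I : ideal R I -> I 1 -> R = I.
Proof.
move=> [[_ _ IM] IR] I1; apply/seteqP; split=> // x Rx.
by rewrite -[x]mulr1; apply: IM.
Qed.

Lemma content_ideal (h : {poly T}) : ideal setT (content setT h).
Proof. by rewrite contentE; split => //; apply: smallest_submodule. Qed.

Lemma polysP R (h : {poly T}) : R 0 -> polys R h <-> forall i, R h`_i.
Proof.
move=> R0; split=> [/allP hR i|hR].
- have [lt|ge] := ltnP i (size h); last by rewrite nth_default.
  by apply/set_mem/hR/mem_nth.
- by apply/allP => x /(nthP 0)[i _ <-]; apply/mem_set.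
Qed.

Lemma content_sub R I (h : {poly T}) :
  ideal R I -> (forall i, I h`_i) -> content R h `<=` I.
Proof.
move=> idI hI; apply: smallest_sub => // x /= /(nthP 0)[i _ <-].
exact: hI.
Qed.

Lemma mem_content R (h : {poly T}) i : content R h h`_i.
Proof.
have [lt|ge] := ltnP i (size h); last first.
  by rewrite nth_default // => I [[[]]].
by apply: (@sub_gen_smallest _ _ [set` (h : seq T)]); apply: mem_nth.
Qed.

Lemma content_polys I (h : {poly T}) :
  ideal setT I -> content setT h `<=` I <-> polys I h.
Proof.
move=> idI; have [[I0 _ _] _] := idI; rewrite (polysP h I0).
by split=> [hI i|hI]; [apply: hI; exact: mem_content|exact: content_sub].
Qed.

Lemma polys_ideal I : ideal setT I -> ideal setT (polys I).
Proof.
move=> [[I0 ID IM] _]; split=> //; split.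
- by apply/polysP => // i; rewrite coef0.
- move=> f g /(polysP _ I0) If /(polysP _ I0) Ig.
  by apply/polysP => // i; rewrite coefD; apply: ID.
- move=> f g _ /(polysP _ I0) Ig; apply/polysP => // i; rewrite coefM.
  by elim/big_ind: _ => // j _; apply: IM.
Qed.

Lemma polysC I d : ideal setT I -> polys I d%:P <-> I d.
Proof.
move=> [[I0 _ _] _]; rewrite polysP //; split=> [/(_ 0%N)|Id i].
  by rewrite coefC.
by rewrite coefC; case: ifP.
Qed.

End Submodules.

Definition prime_ideal (T : comNzRingType) (I : set T) : Prop :=
  [/\ ideal setT I, ~ I 1 & forall a b, I (a * b) -> I a \/ I b].

Section PrimesAndMaximals.
Variable T : comNzRingType.
Implicit Types (R E I : set T).

Lemma prime_compl_mult_closed I : prime_ideal I -> mult_closed (~` I).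
Proof. by move=> [_ I1 IP]; split=> // a b Ia Ib /IP[]. Qed.

Lemma submoduleB I x y : submodule setT I -> I x -> I y -> I (x - y).
Proof.
move=> [_ ID IM] Ix Iy; apply: ID => //.
by rewrite -mulN1r; apply: IM.
Qed.

(** As in Gauss's lemma: if f and g each have a coefficient outside I, with
    least such indices i and j, then the coefficient of index i + j of f g is
    f_i g_j modulo I. *)
Lemma polys_prime I : prime_ideal I -> prime_ideal (polys I).
Proof.
move=> [idI I1 IP]; have [[I0 ID IM] _] := idI; split; first exact: polys_ideal.
  by move=> /(polysC 1 idI).
move=> f g Ifg; apply: contrapT => /not_orP[nf ng].
have least (h : {poly T}) : ~ polys I h ->
    exists2 i, ~ I h`_i & forall j, (j < i)%N -> I h`_j.
  rewrite polysP // => /existsNP nh.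
  have {}nh : exists i, h`_i \notin I.
    by have [i ni] := nh; exists i; apply/negP => /set_mem.
  have [i ni least] := find_ex_minn nh; exists i.
    by move=> Ii; move/negP: ni; apply; apply/mem_set.
  move=> j ji; apply: contrapT => nj.
  have := least j; rewrite leqNgt ji => /implyP; rewrite implybF negbK.
  by move/set_mem.
have [i ni lti] := least f nf; have [j nj ltj] := least g ng.
have [] := IP f`_i g`_j; [|exact: ni|exact: nj].
have lti' : (i < (i + j).+1)%N by rewrite ltnS leq_addr.
have := (polysP _ I0).1 Ifg (i + j)%N.
rewrite coefM (bigD1 (Ordinal lti')) //= addKn => Isum.
rewrite -[X in I X](addrK (\sum_(k < (i + j).+1 | k != Ordinal lti')
  f`_k * g`_(i + j - k))).
apply: submoduleB => //.
elim/big_ind: _ => // k ki.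
have [lt|gt|eq] := ltngtP k i.
- by rewrite mulrC; apply: IM => //; apply: lti.
- apply: IM => //; apply: ltj.
  by rewrite ltn_subLR ?ltn_add2r // -ltnS.
- by case/eqP: ki; apply: val_inj.
Qed.

(** Zorn's lemma above a given member.  The condition on chains leaves out the
    empty one: no family of ideals contains its union, the empty set. *)
Lemma maximal_above (A : set (set T)) I : A I ->
  (forall C : set (set T), C `<=` A -> C !=set0 -> total_on C subset ->
    A (\bigcup_(X in C) X)) ->
  exists2 M, maximal_elt A M & I `<=` M.
Proof.
(* The empty chain is harmless for the sets X with I union X in A, since its
   union then stands for I itself. *)
move=> AI Achain; pose P := [set X | A (I `|` X)].
have [C CP Ctot|X [PX Xmax]] := @Zorn_bigcup _ P.
  rewrite /P /=; have [->|C0] := eqVneq C set0.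
    by rewrite bigcup_set0 setU0.
  have /set0P[X0 CX0] := C0.
  have -> : I `|` \bigcup_(X in C) X = \bigcup_(Y in setU I @` C) Y.
    apply/seteqP; split=> [x [Ix|[X CX Xx]]|x [_ [X CX <-] [Ix|Xx]]].
    - by exists (I `|` X0); [exists X0|left].
    - by exists (I `|` X); [exists X|right].
    - by left.
    - by right; exists X.
  apply: Achain => [_ [X CX <-]||_ _ [X CX <-] [Y CY <-]]; first exact: CP.
    by exists (I `|` X0), X0.
  by have [XY|YX] := Ctot X Y CX CY; [left|right]; apply: setUS.
exists (I `|` X); last by left.
split=> // J AJ IXJ; apply/seteqP; split=> // x Jx.
apply: contrapT => nx; apply: (Xmax J).
  split=> [y Xy|JX]; first by apply: IXJ; right.
  by apply: nx; right; apply: JX.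
by rewrite /P /= setUidr // => y Iy; apply: IXJ; left.
Qed.

End PrimesAndMaximals.

(** * Fractions inside a field *)

Section Fractions.
Variables (T : idomainType) (F : fieldType) (phi : {rmorphism T -> F}).
Variable S : set T.
Hypotheses (S_mult : mult_closed S) (phi_neq0 : forall s, S s -> phi s != 0).
Implicit Types (I : set T) (J : set F).

(** The extension of an ideal [I] to the localization: no sums are needed, as
    finitely many fractions have a common denominator. *)
Definition fractions I : set F := [set phi f / phi s | f in I & s in S].

Let R : set F := localization phi S.

Lemma sub_fractions I : phi @` I `<=` fractions I.
Proof.
move=> _ [f If <-]; exists f => //; exists 1; first by case: S_mult.
by rewrite rmorph1 divr1.
Qed.

Lemma fractions_ideal I : ideal setT I -> ideal R (fractions I).
Proof.
move=> [[I0 ID IM] _]; have [_ SM] := S_mult; split; last first.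
  by move=> _ [f _ [s Ss <-]]; exists f => //; exists s.
split.
- by apply: sub_fractions; exists 0; rewrite ?rmorph0.
- move=> _ _ [f If [s Ss <-]] [g Ig [t St <-]].
  exists (f * t + g * s); first by apply: ID; rewrite mulrC; apply: IM.
  exists (s * t); first exact: SM.
  by rewrite addf_div ?phi_neq0 // rmorphD !rmorphM.
- move=> _ _ [f _ [s Ss <-]] [g Ig [t St <-]].
  exists (f * g); first exact: IM.
  by exists (s * t); [exact: SM|rewrite mulf_div !rmorphM].
Qed.

Lemma extensionE I : ideal setT I -> extension phi R I = fractions I.
Proof.
move=> idI; apply/seteqP; split.
  by apply: smallest_sub; [exact: fractions_ideal|exact: sub_fractions].
move=> _ [f If [s Ss <-]] E [[[_ _ EM] _] IE]; rewrite mulrC.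
apply: EM; last by apply: IE; exists f.
by exists 1 => //; exists s => //; rewrite rmorph1 mul1r.
Qed.

Lemma contraction_ideal J : ideal R J -> ideal setT (phi @^-1` J).
Proof.
move=> [[J0 JD JM] _]; split=> //; split.
- by rewrite /preimage /= rmorph0.
- by move=> f g Jf Jg; rewrite /preimage /= rmorphD; apply: JD.
- move=> a f _ Jf; rewrite /preimage /= rmorphM; apply: JM => //.
  by apply: sub_fractions; exists a.
Qed.

Lemma fractions_contraction J : ideal R J -> fractions (phi @^-1` J) = J.
Proof.
move=> [[_ _ JM] JR]; apply/seteqP; split.
  move=> _ [f Jf [s Ss <-]]; rewrite mulrC; apply: JM => //.
  by exists 1 => //; exists s => //; rewrite rmorph1 mul1r.
move=> x Jx; have [f _ [s Ss xE]] := JR x Jx; exists f; last by exists s.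
rewrite /preimage /= -[phi f](divfK (phi_neq0 Ss)) xE mulrC.
by apply: JM => //; apply: sub_fractions; exists s.
Qed.

Lemma proper_ideal_disjoint J s :
  ideal R J -> J `<` R -> J (phi s) -> ~ S s.
Proof.
move=> idJ [_ nRJ] Js Ss; apply: nRJ; rewrite (ideal_one idJ) //.
rewrite -(mulVf (phi_neq0 Ss)); have [[_ _ JM] _] := idJ; apply: JM => //.
by exists 1 => //; exists s => //; rewrite rmorph1 mul1r.
Qed.

(** The sets of elements cleared by a given denominator form a directed family,
    because s t clears whatever s or t clears. *)
Lemma common_denominator (p : {poly F}) : polys R p ->
  exists2 s, S s & exists q, (phi s)%:P * p = map_poly phi q.
Proof.
move=> Rp; pose cleared s := [set x | exists a, phi s * x = phi a].
have dir : directed S cleared.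
  split; first by exists 1; case: S_mult.
  move=> s t Ss St; exists (s * t); first by case: S_mult => _; apply.
  move=> x [[a xa]|[a xa]].
    by exists (t * a); rewrite !rmorphM -xa mulrCA mulrA.
  by exists (s * a); rewrite !rmorphM -mulrA xa.
have sub : [set` (p : seq F)] `<=` \bigcup_(s in S) cleared s.
  move=> x px; have /set_mem[a _ [s Ss <-]] := allP Rp x px.
  by exists s => //; exists a; rewrite mulrC divfK // phi_neq0.
have [s Ss ps] := directed_seq dir sub; exists s => //.
have [i|a aE] := @choice nat T (fun i x => phi s * p`_i = phi x).
  have [lt|ge] := ltnP i (size p); first exact/ps/mem_nth.
  by exists 0; rewrite nth_default // mulr0 rmorph0.
exists (\poly_(i < size p) a i); apply/polyP => i.
rewrite coefCM coef_map coef_poly aE; case: ltnP => // ge.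
by rewrite -aE nth_default // mulr0 raddf0.
Qed.

End Fractions.

(** * Submodules of the quotient field *)

Section QuotientField.
Variable D : idomainType.
Local Notation K := {fraction D}.
Local Notation D1 := (range (tofrac : D -> K)).
Implicit Types (E F : set K) (I : set D).

Lemma tofrac_inj : injective (tofrac : D -> K).
Proof. by move=> a b /eqP; rewrite tofrac_eq => /eqP. Qed.

Lemma fraction_div (x : K) :
  exists a, exists2 b, b != 0 & x = tofrac a / tofrac b :> K.
Proof.
elim/quotW: x => r; exists (\n_r), (\d_r); first exact: denom_ratioP.
have d0 : tofrac \d_r != 0 :> K by rewrite tofrac_eq0 denom_ratioP.
apply: (mulIf d0); rewrite divfK //; unlock FracField.tofrac.
rewrite -[LHS]FracField.pi_mul; apply/eqmodP; rewrite /= FracField.equivfE.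
rewrite /FracField.mulf !numden_Ratio ?oner_neq0 ?mulf_neq0 ?denom_ratioP //.
by rewrite !mulr1 mulrC.
all: exact: oner_neq0.
Qed.

Lemma image_submodule I : ideal setT I -> submodule D1 (tofrac @` I).
Proof.
move=> [[I0 ID IM] _]; split.
- by exists 0; rewrite // rmorph0.
- move=> _ _ [a Ia <-] [b Ib <-]; exists (a + b); first exact: ID.
  by rewrite rmorphD.
- move=> _ _ [a _ <-] [b Ib <-]; exists (a * b); first exact: IM.
  by rewrite rmorphM.
Qed.

Lemma preimage_ideal E : submodule D1 E -> ideal setT (tofrac @^-1` E).
Proof.
move=> [E0 ED EM]; split=> //; split.
- by rewrite /preimage /= rmorph0.
- by move=> a b Ea Eb; rewrite /preimage /= rmorphD; apply: ED.
- by move=> a b _ Eb; rewrite /preimage /= rmorphM; apply: EM => //; exists a.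
Qed.

Lemma image_Fbar I : ideal setT I -> nonzero I -> Fbar (tofrac @` I).
Proof.
move=> idI [a Ia a0]; split; first exact: image_submodule.
by exists (tofrac a); [exists a|rewrite tofrac_eq0].
Qed.

Lemma setT_ideal (T : comNzRingType) : ideal setT (setT : set T).
Proof. by []. Qed.

Lemma range_Fbar : @Fbar D D1.
Proof.
by apply: image_Fbar; [exact: setT_ideal|exists 1; rewrite ?oner_neq0].
Qed.

Lemma sub_range E : submodule D1 E -> E 1 -> D1 `<=` E.
Proof. by move=> [_ _ EM] E1 x Dx; rewrite -[x]mulr1; apply: EM. Qed.

Lemma fgmod_range : @fgmod D D1.
Proof.
split; first exact: range_Fbar.
exists [:: 1]; apply/seteqP; split.
  apply: sub_range; first exact: smallest_submodule.
  by apply: sub_gen_smallest; rewrite /= inE.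
apply: smallest_sub; first by case: range_Fbar.
by move=> x; rewrite /= inE => /eqP ->; exists 1; rewrite ?rmorph1.
Qed.

Lemma fgmod_smallest (s : seq K) :
  (exists2 x, x \in s & x != 0) -> fgmod (smallest (submodule D1) [set` s]).
Proof.
move=> [x xs x0]; split; last by exists s.
split; first exact: smallest_submodule.
by exists x => //; apply: sub_gen_smallest.
Qed.

(** Finitely generated ideals of D have finitely generated images in the
    quotient field; both inclusions come from minimality. *)
Lemma image_smallest (s : seq D) :
  tofrac @` smallest (submodule setT) [set` s] =
  smallest (submodule D1) [set` map tofrac s].
Proof.
apply/seteqP; split.
  move=> _ [a sa <-].
  apply: (sa (tofrac @^-1` smallest (submodule D1) [set` map tofrac s])); split.
    by case: (preimage_ideal (smallest_submodule D1 [set` map tofrac s])).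
  by move=> b sb; apply: sub_gen_smallest; apply: map_f.
apply: smallest_sub.
  by apply: image_submodule; split=> //; apply: smallest_submodule.
by move=> _ /= /mapP[b sb ->]; exists b => //; apply: sub_gen_smallest.
Qed.

Lemma content_nonzero (h : {poly D}) : h != 0 -> nonzero (content setT h).
Proof.
move=> h0; exists (lead_coef h); last by rewrite lead_coef_eq0.
exact: mem_content.
Qed.

Lemma fgmod_content (h : {poly D}) :
  h != 0 -> fgmod (tofrac @` content setT h).
Proof.
move=> h0; split; last first.
  by exists (map tofrac h); rewrite contentE image_smallest.
by apply: image_Fbar; [exact: content_ideal|exact: content_nonzero].
Qed.

Lemma scaleK z E : z != 0 -> scale z (scale z^-1 E) = E.
Proof.
move=> z0; apply/seteqP; split=> [_ [_ [x Ex <-] <-]|x Ex].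
  by rewrite mulVKf.
by exists (z^-1 * x); [exists x|exact: mulVKf].
Qed.

Lemma scale_submodule z E : submodule D1 E -> submodule D1 (scale z E).
Proof.
move=> [E0 ED EM]; split.
- by exists 0; rewrite ?mulr0.
- move=> _ _ [x Ex <-] [y Ey <-]; exists (x + y); first exact: ED.
  by rewrite mulrDr.
- move=> a _ Da [x Ex <-]; exists (a * x); first exact: EM.
  by rewrite mulrCA.
Qed.

Lemma scale_Fbar z E : z != 0 -> Fbar E -> Fbar (scale z E).
Proof.
move=> z0 [subE [x Ex x0]]; split; first exact: scale_submodule.
by exists (z * x); [exists x|exact: mulf_neq0].
Qed.

Lemma scale_fgmod z F : z != 0 -> fgmod F -> fgmod (scale z F).
Proof.
move=> z0 [FF [s Fs]]; split; first exact: scale_Fbar.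
exists (map ( *%R z) s); rewrite {}Fs; apply/seteqP; split.
  have [G0 GD GM] := smallest_submodule D1 [set` map ( *%R z) s].
  move=> _ [x sx <-].
  apply: (sx [set y | smallest (submodule D1) [set` map ( *%R z) s] (z * y)]).
  split.
    split=> /= [|y1 y2 G1 G2|a y Da Gy]; first by rewrite mulr0.
      by rewrite mulrDr; apply: GD.
    by rewrite mulrCA; apply: GM.
  by move=> y sy; apply: sub_gen_smallest; apply: map_f.
apply: smallest_sub; first exact/scale_submodule/smallest_submodule.
by move=> _ /= /mapP[y sy ->]; exists y => //; apply: sub_gen_smallest.
Qed.

Lemma scale_sub z E F : E `<=` F -> scale z E `<=` scale z F.
Proof. exact: image_subset. Qed.

End QuotientField.

(** * Semistar operations *)

Section SemistarBasics.
Variables (D : idomainType) (star : set {fraction D} -> set {fraction D}).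
Hypothesis star_semistar : semistar star.
Local Notation K := {fraction D}.
Local Notation D1 := (range (tofrac : D -> K)).
Implicit Types (E F : set K) (I : set D).

Lemma semistar_unit E : Fbar E -> E `<=` D1 -> star E = star D1 <-> star E 1.
Proof.
have [starF _ starS starI starK] := star_semistar.
move=> FE ED; split=> [->|E1].
  by apply: starI; [exact: range_Fbar|exists 1; rewrite ?rmorph1].
apply/seteqP; split; first by apply: starS => //; exact: range_Fbar.
rewrite -[X in _ `<=` X]starK //; apply: starS.
- exact: range_Fbar.
- exact: starF.
- by apply: sub_range => //; case: (starF E FE).
Qed.

(** A nonzero e in E gives e D in E, so the closure of E contains e K = K. *)
Lemma trivial_semistar_range : star D1 = setT -> trivial_semistar star.
Proof.
have [starF starZ starS starI starK] := star_semistar.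
move=> starD E FE; apply/seteqP; split=> // x _.
have [subE [e Ee e0]] := FE.
have eD : Fbar (scale e D1) by apply: scale_Fbar => //; exact: range_Fbar.
have eDE : scale e D1 `<=` E.
  move=> _ [a Da <-]; rewrite mulrC.
  by have [_ _ EM] := subE; apply: EM.
apply: (starS _ _ eD FE eDE); rewrite starZ ?starD //; last exact: range_Fbar.
by exists (e^-1 * x); rewrite ?mulVKf.
Qed.

Lemma finite_type_fgmod F : fgmod F -> finite_type star F = star F.
Proof.
have [_ _ starS _ _] := star_semistar.
move=> fgF; apply/seteqP; split; last by move=> x Fx; exists F; first split.
move=> x [G [[FG _] GF] Gx]; apply: starS Gx => //.
by case: fgF.
Qed.

(** Both closures agree on D and on the content of h, as these are finitely
    generated. *)
Lemma Nstar_finite_type : Nstar star = Nstar (finite_type star).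
Proof.
apply/seteqP; split=> h [h0 hN]; split=> //; move: hN;
  by rewrite (finite_type_fgmod (fgmod_range D))
             (finite_type_fgmod (fgmod_content h0)).
Qed.

(** Two finitely generated submodules of E lie in their sum, generated by the
    concatenated lists.  This is what makes the finite type closure a submodule
    and idempotent. *)
Lemma directed_fgmod E : Fbar E ->
  directed [set F | fgmod F /\ F `<=` E] star.
Proof.
have [_ _ starS _ _] := star_semistar.
move=> [subE [e Ee e0]]; split.
  exists (smallest (submodule D1) [set` [:: e]]); split.
    by apply: fgmod_smallest; exists e; rewrite ?mem_head.
  by apply: smallest_sub => // x; rewrite /= inE => /eqP ->.
move=> F G [[FF [s Fs]] FE] [[FG [t Gt]] GE].
pose H := smallest (submodule D1) [set` s ++ t].
have sH : F `<=` H.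
  rewrite Fs; apply: smallest_sub; first exact: smallest_submodule.
  by move=> x sx; apply: sub_gen_smallest; rewrite /= mem_cat (sx : x \in s).
have tH : G `<=` H.
  rewrite Gt; apply: smallest_sub; first exact: smallest_submodule.
  move=> x tx; apply: sub_gen_smallest.
  by rewrite /= mem_cat (tx : x \in t) orbT.
have FH : Fbar H.
  split; first exact: smallest_submodule.
  by have [_ [x Fx x0]] := FF; exists x => //; apply: sH.
have HE : H `<=` E.
  apply: smallest_sub => // x; rewrite /= mem_cat => /orP[xs|xt].
    by apply: FE; rewrite Fs; apply: sub_gen_smallest.
  by apply: GE; rewrite Gt; apply: sub_gen_smallest.
exists H; first by split=> //; split=> //; exists (s ++ t).
by rewrite subUset; split; apply: starS.
Qed.

Lemma finite_type_Fbar E : Fbar E -> Fbar (finite_type star E).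
Proof.
have [starF _ _ starI _] := star_semistar.
move=> FE; have dirE := directed_fgmod FE; split.
  by apply: bigcup_submodule => // F [[FF _] _]; case: (starF F FF).
have [[F PF] _] := dirE; have [[FF _] _] := PF; have [_ [x Fx x0]] := FF.
by exists x => //; exists F => //; exact: starI.
Qed.

Lemma finite_type_sub E : Fbar E -> E `<=` finite_type star E.
Proof.
have [starF _ _ starI _] := star_semistar.
move=> [subE [e Ee e0]] x Ex.
pose F := smallest (submodule D1) [set` [:: x; e]].
have fgF : fgmod F by apply: fgmod_smallest; exists e; rewrite ?inE ?eqxx ?orbT.
exists F; last first.
  apply: starI; first by case: fgF.
  by apply: sub_gen_smallest; rewrite /= mem_head.
split=> //; apply: smallest_sub => // y.
by rewrite /= !inE => /orP[] /eqP ->.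
Qed.

Lemma finite_typeS E F : E `<=` F -> finite_type star E `<=` finite_type star F.
Proof.
move=> EF x [G [fgG GE] Gx]; exists G => //; split=> //.
exact: subset_trans EF.
Qed.

(** Finitely many elements of the finite type closure of E all lie in the
    closure of a single finitely generated F contained in E, and closing F a
    second time adds nothing. *)
Lemma finite_typeK E :
  Fbar E -> finite_type star (finite_type star E) = finite_type star E.
Proof.
have [starF _ starS _ starK] := star_semistar.
move=> FE; apply/seteqP; split; last first.
  exact: finite_type_sub (finite_type_Fbar FE).
move=> x [G [[FG [s Gs]] GE] Gx].
have [|F [[FF fgF] FE'] sF] := directed_seq (s := s) (directed_fgmod FE).
  by move=> y sy; apply: GE; rewrite Gs; apply: sub_gen_smallest.
exists F => //; rewrite -(starK F FF); apply: starS Gx => //.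
  exact: starF.
by rewrite Gs; apply: smallest_sub => //; case: (starF F FF).
Qed.

(** One inclusion is enough for compatibility with scaling: the converse is the
    same statement for the inverse scalar. *)
Lemma finite_type_scale_sub z E : z != 0 ->
  scale z (finite_type star E) `<=` finite_type star (scale z E).
Proof.
have [_ starZ _ _ _] := star_semistar.
move=> z0 _ [x [F [[FF fgF] FE] Fx] <-]; exists (scale z F).
  by split; [exact: scale_fgmod|exact: scale_sub].
by rewrite starZ //; exists x.
Qed.

Lemma finite_type_semistar : semistar (finite_type star).
Proof.
split=> [E|z E z0 FE|E F _ _|E|E].
- exact: finite_type_Fbar.
- apply/seteqP; split; last exact: finite_type_scale_sub.
  rewrite -[X in X `<=` _](scaleK _ z0); apply: scale_sub.
  apply: subset_trans (finite_type_scale_sub (E := scale z E) _) _.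
    by rewrite invr_eq0.
  by have := @scaleK D z^-1 E; rewrite invrK => ->; rewrite ?invr_eq0.
- exact: finite_typeS.
- exact: finite_type_sub.
- exact: finite_typeK.
Qed.

Lemma finite_type_finite_character E x : finite_type star E x ->
  exists F, [/\ fgmod F, F `<=` E & finite_type star F x].
Proof. by move=> [F [fgF FE] Fx]; exists F; rewrite finite_type_fgmod. Qed.

End SemistarBasics.

(** * Quasi-maximal ideals of a semistar operation of finite type *)

Section QuasiMaximal.
Variables (D : idomainType) (star : set {fraction D} -> set {fraction D}).
Local Notation K := {fraction D}.
Local Notation D1 := (range (tofrac : D -> K)).
Hypothesis star_semistar : semistar star.
Hypothesis finite_character : forall E x, star E x ->
  exists F : set K, [/\ fgmod F, F `<=` E & star F x].
Hypothesis star_nontrivial : star D1 <> setT.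
Implicit Types (E F : set K) (I J Q : set D).

(** Monotony for ideals that may be zero: the map is constrained only at nonzero
    submodules, but by finite character the closure of the zero ideal is
    empty. *)
Lemma star_image_sub I J : ideal setT I -> ideal setT J -> I `<=` J ->
  star (tofrac @` I) `<=` star (tofrac @` J).
Proof.
have [_ _ starS _ _] := star_semistar.
move=> idI idJ IJ x /finite_character[F [fgF FI Fx]].
have FJ : F `<=` tofrac @` J by apply: subset_trans FI (image_subset IJ).
apply: starS Fx => //; first by case: fgF.
have [[_ [y Fy y0]] _] := fgF; have [a Ja aE] := FJ y Fy.
by apply: image_Fbar => //; exists a => //; rewrite -(tofrac_eq0 a) aE.
Qed.

Lemma quasi_closure I (cl := tofrac @^-1` star (tofrac @` I)) :
  ideal setT I -> nonzero I -> quasi_ideal star cl /\ I `<=` cl.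
Proof.
have [starF _ starS starI starK] := star_semistar.
move=> idI nzI; have FI := image_Fbar idI nzI.
have Icl : I `<=` cl by move=> a Ia; apply: (starI _ FI); exists a.
have idcl : ideal setT cl by apply: preimage_ideal; case: (starF _ FI).
have nzcl : nonzero cl by have [a Ia a0] := nzI; exists a => //; apply: Icl.
split=> //; split=> //; apply/seteqP; split=> a; last first.
  by move=> cla; apply: (starI _ (image_Fbar idcl nzcl)); exists a.
rewrite /cl /preimage /= -[in X in _ -> X](starK _ FI).
apply: starS; [exact: image_Fbar|exact: starF|by move=> _ [b clb <-]].
Qed.

(** Finite character is what makes unions of chains quasi-ideals: an element of
    the closure of the union comes from a finitely generated submodule, which
    already lies in one member of the chain. *)
Lemma quasi_ideal_chain (C : set (set D)) :
  C `<=` [set I | quasi_ideal star I /\ I `<` setT] ->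
  C !=set0 -> total_on C subset ->
  quasi_ideal star (\bigcup_(I in C) I) /\ \bigcup_(I in C) I `<` setT.
Proof.
have [starF _ starS starI starK] := star_semistar.
move=> CQ C0 Ctot; have dirC := directed_chain C0 Ctot.
have idU : ideal setT (\bigcup_(I in C) I).
  split=> //; apply: (bigcup_submodule dirC) => I CI.
  by have [[[]]] := CQ I CI.
have nzU : nonzero (\bigcup_(I in C) I).
  have [I CI] := C0; have [[_ [a Ia a0] _] _] := CQ I CI.
  by exists a => //; exists I.
split; last first.
  split=> // /(_ 1 Logic.I)[I CI I1]; have [[idI _ _] [_ nI]] := CQ I CI.
  by apply: nI; rewrite (ideal_one idI).
split=> //; apply/seteqP; split=> a; last first.
  by move=> Ua; apply: (starI _ (image_Fbar idU nzU)); exists a.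
move=> /finite_character[F [[FF [s Fs]] FU Fa]].
have [||I CI sI] := directed_seq (s := s) (P := C)
  (F := image^~ (tofrac : D -> K)).
- have [_ dirC2] := dirC; split=> // I J CI CJ.
  have [L CL IJL] := dirC2 I J CI CJ; exists L => //.
  by rewrite -image_setU; apply: image_subset.
- move=> x xs; have [|b [I CI Ib] <-] := FU x.
    by rewrite Fs; apply: sub_gen_smallest.
  by exists I => //; exists b.
exists I => //; have [[idI nzI <-] _] := CQ I CI.
apply: (starS _ _ FF (image_Fbar idI nzI)) Fa; rewrite Fs.
by apply: smallest_sub => //; apply: image_submodule.
Qed.

(** If 1 were in the closure of b D for every nonzero b, the closure of D would
    contain all the inverses 1/b, hence be K.  This provides a quasi-maximal
    ideal above the zero ideal. *)
Lemma proper_principal_closure : exists I,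
  [/\ ideal setT I, nonzero I & ~ star (tofrac @` I) 1].
Proof.
have [starF starZ starS starI starK] := star_semistar.
apply: contrapT => /forallNP noI; apply: star_nontrivial.
have [starM _] := starF _ (@range_Fbar D).
apply/seteqP; split=> // x _; have [a [b b0 ->]] := fraction_div x.
have [_ _ EM] := starM; apply: EM; first by exists a.
have b0' : tofrac b != 0 :> K by rewrite tofrac_eq0.
pose I := [set b * c | c in [set: D]].
have IE : tofrac @` I = scale (tofrac b) D1.
  apply/seteqP; split=> [_ [_ [c _ <-] <-]|_ [_ [c _ <-] <-]].
    by exists (tofrac c); [exists c|rewrite rmorphM].
  by exists (b * c); [exists c|rewrite rmorphM].
apply: contrapT => nb; apply: (noI I); split.
- split=> //; split.
  + by exists 0; rewrite ?mulr0.
  + by move=> _ _ [c _ <-] [d _ <-]; exists (c + d); rewrite ?mulrDr.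
  + by move=> c _ _ [d _ <-]; exists (c * d); rewrite // mulrCA.
- by exists b => //; exists 1; rewrite ?mulr1.
- rewrite IE starZ //; last exact: range_Fbar.
  move=> [y Dy by1]; apply: nb; rewrite -[_^-1]mulr1 -by1 mulKf //.
Qed.

Lemma quasi_maximal_above I : ideal setT I -> ~ star (tofrac @` I) 1 ->
  exists2 Q, quasi_maximal star Q & I `<=` Q.
Proof.
move=> idI nI1.
wlog nzI : I idI nI1 / nonzero I.
  move=> wl; have [nzI|zI] := pselect (nonzero I); first exact: wl.
  have [J [idJ nzJ nJ1]] := proper_principal_closure.
  have [Q QM JQ] := wl J idJ nJ1 nzJ; exists Q => // a Ia.
  have [->|a0] := eqVneq a 0; last by case: zI; exists a.
  by apply: JQ; case: idJ => [[J0 _ _] _]; exact: J0.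
have [qI Icl] := quasi_closure idI nzI.
have [|Q QM clQ] := maximal_above (conj qI _) quasi_ideal_chain.
  by split=> // /(_ 1 Logic.I); rewrite /preimage /= rmorph1.
by exists Q => //; apply: subset_trans clQ.
Qed.

Lemma quasi_maximal_not1 Q : quasi_maximal star Q -> ~ Q 1.
Proof.
move=> [[[idQ _ _] [_ nQ]] _] Q1.
by apply: nQ; rewrite (ideal_one idQ).
Qed.

Lemma quasi_maximal_closed Q a :
  quasi_maximal star Q -> star (tofrac @` Q) (tofrac a) -> Q a.
Proof. by move=> [[[_ _ QE] _] _] Qa; rewrite -QE. Qed.

(** Suppose that a b is in Q but a is not.  By maximality the closure of
    J = Q + a D contains 1, so b lies in b times that closure, which is the
    closure of b J; as b J is contained in Q, b is in Q. *)
Lemma quasi_maximal_prime Q : quasi_maximal star Q -> prime_ideal Q.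
Proof.
have [starF starZ starS starI starK] := star_semistar.
move=> QM; have [[[idQ nzQ _] _] Qmax] := QM; split=> //.
  exact: quasi_maximal_not1.
move=> a b Qab; apply: contrapT => /not_orP[nQa nQb].
have [[Q0 QD QMl] _] := idQ.
pose J := [set q + c * a | q in Q & c in [set: D]].
have QJ : Q `<=` J.
  by move=> q Qq; exists q => //; exists 0; rewrite ?mul0r ?addr0.
have Ja : J a by exists 0 => //; exists 1; rewrite ?mul1r ?add0r.
have idJ : ideal setT J.
  split=> //; split; first exact: QJ.
    move=> _ _ [q Qq [c _ <-]] [q' Qq' [c' _ <-]].
    exists (q + q'); first exact: QD.
    by exists (c + c'); rewrite // mulrDl addrACA.
  move=> d _ _ [q Qq [c _ <-]]; exists (d * q); first exact: QMl.
  by exists (d * c); rewrite // mulrDr mulrA.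
have nzJ : nonzero J by have [q Qq q0] := nzQ; exists q => //; apply: QJ.
have [J1|nJ1] := pselect (star (tofrac @` J) 1); last first.
  have [M MM JM] := quasi_maximal_above idJ nJ1.
  have [AM _] := MM; apply: nQa; rewrite -(Qmax M AM); first exact: JM.
  by apply: subset_trans QJ JM.
have b0 : b != 0 by apply: contra_not_neq nQb => ->.
apply: nQb; apply: quasi_maximal_closed QM _.
have b0' : tofrac b != 0 :> K by rewrite tofrac_eq0.
have FJ := image_Fbar idJ nzJ.
apply: (starS (scale (tofrac b) (tofrac @` J))).
- exact: scale_Fbar.
- exact: image_Fbar.
- move=> _ [_ [_ [q Qq [c _ <-]] <-] <-]; exists (b * (q + c * a)).
    rewrite mulrDr; apply: QD; first exact: QMl.
    by rewrite mulrCA [b * a]mulrC; apply: QMl.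
  by rewrite rmorphM.
- by rewrite starZ //; exists 1; rewrite ?mulr1.
Qed.

Lemma Nstar_unit h :
  Nstar star h <-> h != 0 /\ star (tofrac @` content setT h) 1.
Proof.
have cD : tofrac @` content setT h `<=` D1 by apply: image_subset.
split=> -[h0 hN]; split=> //; move: hN;
  by have [Fc _] := fgmod_content h0; rewrite semistar_unit.
Qed.

Lemma quasi_maximal_Nstar Q h :
  quasi_maximal star Q -> polys Q h -> ~ Nstar star h.
Proof.
move=> QM Qh /Nstar_unit[h0 h1]; apply: (quasi_maximal_not1 QM).
apply: (quasi_maximal_closed QM); rewrite rmorph1.
have [[[idQ _ _] _] _] := QM.
apply: (star_image_sub (content_ideal h) idQ _ h1).
exact/(content_polys _ idQ).
Qed.

(** With n = size f, the coefficients of f + X^n g are those of f followed by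
    those of g. *)
Lemma content_directed (J : set {poly D}) : ideal setT J ->
  directed J (content setT).
Proof.
move=> [[J0 JD JM] _]; split; first by exists 0.
move=> f g Jf Jg; exists (f + 'X^(size f) * g).
  by apply: JD => //; apply: JM.
set u := f + _; have [[u0 _ _] _] := content_ideal u.
rewrite subUset; split; apply: (content_sub (content_ideal u)) => i.
  have [lt|ge] := ltnP i (size f); last by rewrite nth_default.
  have := @mem_content D setT u i.
  by rewrite coefD coefXnM lt addr0.
have := @mem_content D setT u (size f + i)%N.
rewrite coefD coefXnM ltnNge leq_addr /= addKn nth_default ?add0r //.
exact: leq_addr.
Qed.

(** The union of the contents of the members of J is a directed union, so by
    finite character its closure contains 1 only if the closure of the content
    of a single member does. *)
Lemma disjoint_ideal_sub (J : set {poly D}) :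
  ideal setT J -> (forall h, J h -> ~ Nstar star h) ->
  exists2 Q, quasi_maximal star Q & J `<=` polys Q.
Proof.
have [_ _ starS _ _] := star_semistar.
move=> idJ JN; have dirJ := content_directed idJ.
pose c := \bigcup_(h in J) content setT h.
have idc : ideal setT c.
  split=> //; apply: (bigcup_submodule dirJ) => h _.
  by case: (content_ideal h).
have [|Q QM cQ] := quasi_maximal_above idc; last first.
  exists Q => // h Jh; have [[[idQ _ _] _] _] := QM.
  by apply/(content_polys _ idQ) => a ha; apply: cQ; exists h.
move=> /finite_character[F [[FF [s Fs]] Fc F1]].
have [||h Jh sh] := directed_seq (s := s) (P := J)
    (F := fun h => tofrac @` content setT h : set K).
- have [J0 dirJ2] := dirJ; split=> // f g Jf Jg.
  have [h Jh fgh] := dirJ2 f g Jf Jg; exists h => //.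
  by rewrite -image_setU; apply: image_subset.
- move=> x xs; have [|b [h Jh hb] <-] := Fc x.
    by rewrite Fs; apply: sub_gen_smallest.
  by exists h => //; exists b.
have Fh : F `<=` tofrac @` content setT h.
  by rewrite Fs; apply: smallest_sub => //; apply/image_submodule/content_ideal.
have h0 : h != 0.
  have [_ [x Fx]] := FF; apply: contra_neq => h0.
  have [a ca <-] := Fh x Fx; suff -> : a = 0 by rewrite rmorph0.
  apply: (ca [set 0]); rewrite h0 polyseq0; split=> //; split=> //; split=> //.
    by move=> y z -> ->; rewrite addr0.
  by move=> y z _ ->; rewrite mulr0.
apply: (JN h Jh); apply/Nstar_unit; split=> //.
by apply: (starS _ _ FF) F1 => //; have [] := fgmod_content h0.
Qed.

Lemma Nstar_compl :
  Nstar star = ~` (\bigcup_(Q in quasi_maximal star) polys Q).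
Proof.
apply/seteqP; split=> [h hN [Q QM Qh]|h nQh].
  exact: quasi_maximal_Nstar QM Qh hN.
apply: contrapT => nN; apply: nQh.
pose J := [set h * g | g in [set: {poly D}]].
have [||Q QM JQ] := @disjoint_ideal_sub J; last first.
- by exists Q => //; apply: JQ; exists 1; rewrite ?mulr1.
- move=> _ [g _ <-] /Nstar_unit[hg0 hg1]; apply: nN; apply/Nstar_unit.
  split; first by apply: contraNneq hg0 => ->; rewrite mul0r.
  move: hg1; apply: star_image_sub; try exact: content_ideal.
  have idh := content_ideal h; apply/content_polys => //.
  have [[_ _ PM] _] := polys_ideal idh; rewrite mulrC; apply: PM => //.
  by apply/content_polys.
- split=> //; split; first by exists 0; rewrite ?mulr0.
    by move=> _ _ [f _ <-] [g _ <-]; exists (f + g); rewrite ?mulrDr.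
  by move=> f _ _ [g _ <-]; exists (f * g); rewrite // mulrCA.
Qed.

Lemma Nstar_mult_closed : mult_closed (Nstar star).
Proof.
rewrite Nstar_compl; split.
  move=> [Q QM] /polysC; have [[[idQ _ _] _] _] := QM.
  by move/(_ idQ); apply: quasi_maximal_not1.
move=> f g nf ng [Q QM Qfg].
have [_ _ PQ] := polys_prime (quasi_maximal_prime QM).
by have [Qf|Qg] := PQ f g Qfg; [apply: nf|apply: ng]; exists Q.
Qed.

Lemma Nstar_saturated : saturated (Nstar star).
Proof.
rewrite Nstar_compl => f g nfg; split=> -[Q QM Qf]; apply: nfg; exists Q => //;
  have [[[/polys_ideal[[_ _ PM] _] _ _] _] _] := QM.
  by rewrite mulrC; apply: PM.
by apply: PM.
Qed.

End QuasiMaximal.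

(** * The Nagata ring and its maximal ideals *)

Section PolyFrac.
Variable D : idomainType.

Fact polyfrac_zmod_morphism : zmod_morphism (@polyfrac D).
Proof. by move=> f g; rewrite /polyfrac !rmorphB. Qed.

Fact polyfrac_monoid_morphism : monoid_morphism (@polyfrac D).
Proof. by split=> [|f g]; rewrite /polyfrac ?rmorph1 ?rmorphM. Qed.

HB.instance Definition _ := GRing.isZmodMorphism.Build _ _ (@polyfrac D)
  polyfrac_zmod_morphism.
HB.instance Definition _ := GRing.isMonoidMorphism.Build _ _ (@polyfrac D)
  polyfrac_monoid_morphism.

Lemma polyfrac_inj : injective (@polyfrac D).
Proof.
move=> f g /tofrac_inj /map_inj_poly; apply; first exact: tofrac_inj.
by rewrite rmorph0.
Qed.

Lemma polyfrac_eq0 (f : {poly D}) : (polyfrac f == 0) = (f == 0).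
Proof. by rewrite -(inj_eq polyfrac_inj) rmorph0. Qed.

End PolyFrac.

Section LocalNagata.
Variables (D : idomainType) (Q : set D).
Hypothesis Q_prime : prime_ideal Q.
Local Notation K := {fraction D}.
Local Notation phi := (tofrac : D -> K).

Let S_mult : mult_closed (~` Q). Proof. exact: prime_compl_mult_closed. Qed.

Let idQ : ideal setT Q. Proof. by case: Q_prime. Qed.

Let phi_neq0 s : (~` Q) s -> phi s != 0.
Proof.
move=> ns; rewrite tofrac_eq0; apply: contra_not_neq ns => ->.
by case: idQ => [[]].
Qed.

(** The fractions with numerator in Q form the maximal ideal of D_Q. *)
Lemma localring_maximal_not1 : ~ fractions phi (~` Q) Q 1.
Proof.
move=> [a Qa [s Qs /(canRL (divfK (phi_neq0 Qs)))]].
by rewrite mul1r => /tofrac_inj aE; apply: Qs; rewrite -aE.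
Qed.

(** A coefficient of s outside Q is a unit of D_Q, so s has unit content
    over D_Q. *)
Lemma nagata_localring (f s : {poly D}) :
  ~ polys Q s -> nagata (localring Q) (polyfrac f / polyfrac s).
Proof.
have [[Q0 _ _] _] := idQ.
have idR := fractions_ideal S_mult phi_neq0 (@setT_ideal D).
have sR := @sub_fractions _ _ phi _ S_mult setT.
have mapR (g : {poly D}) : polys (localring Q) (map_poly phi g).
  apply/polysP; first by case: idR => [[]].
  by move=> i; rewrite coef_map; apply: sR; exists g`_i.
move=> ns; exists (map_poly phi f); first exact: mapR.
exists (map_poly phi s) => //; split; first exact: mapR.
have [i ni] : exists i, ~ Q s`_i by apply/existsNP; rewrite -polysP.
have idc : ideal (localring Q) (content (localring Q) (map_poly phi s)).
  split.
    split=> [E [[[]]] //|x y cx cy E EA|a x Ra cx E EA].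
    - by have [[[_ ED _] _] _] := EA; apply: ED; [apply: cx|apply: cy].
    - by have [[[_ _ EM] _] _] := EA; apply: EM => //; apply: cx.
  apply: content_sub; first exact: idR.
  by move=> j; rewrite coef_map; apply: sR; exists s`_j.
symmetry; apply: (ideal_one idc).
rewrite -(mulVf (phi_neq0 ni)); have [[_ _ cM] _] := idc; apply: cM.
  by exists 1 => //; exists s`_i => //; rewrite rmorph1 mul1r.
by have := @mem_content _ (localring Q) (map_poly phi s) i; rewrite coef_map.
Qed.

(** Write z = f / g with g of unit content over D_Q, and clear the denominators
    of f and g with d and e outside Q.  Then h = d e g works: if all the
    coefficients of e g were in Q, those of g would be in the maximal ideal of
    D_Q. *)
Lemma nagata_denominator (z : {fraction {poly K}}) : nagata (localring Q) z ->
  exists2 h, ~ polys Q h & exists f, polyfrac h * z = polyfrac f.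
Proof.
move=> [f Rf [g [Rg cg] <-]].
have [d Qd [f0 f0E]] := common_denominator S_mult phi_neq0 Rf.
have [e Qe [g0 g0E]] := common_denominator S_mult phi_neq0 Rg.
have idm := fractions_ideal S_mult phi_neq0 idQ.
have [[Q0 _ _] _] := idQ.
have ng0 : ~ polys Q g0.
  rewrite polysP // => Qg0; apply: localring_maximal_not1.
  apply: (content_sub (h := g) idm) => [i|].
    exists g0`_i => //; exists e => //.
    apply: (canLR (mulfK (phi_neq0 Qe))); rewrite mulrC.
    by have /(congr1 (coefp i)) := g0E; rewrite /= coefCM coef_map.
  rewrite [X in X 1]cg; apply: (sub_fractions S_mult).
  by exists 1; rewrite ?rmorph1.
have g_neq0 : tofrac g != 0 :> {fraction {poly K}}.
  rewrite tofrac_eq0; apply: contra_not_neq ng0 => g0'.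
  suff -> : g0 = 0 by case: (polys_ideal idQ) => [[]].
  apply: (map_inj_poly (f := phi)); rewrite ?rmorph0 //.
    exact: tofrac_inj.
  by rewrite -g0E g0' mulr0.
exists (d%:P * g0).
  have [_ _ PQ] := polys_prime Q_prime.
  by move=> /PQ[/(polysC _ idQ)|].
exists (e%:P * f0); rewrite /polyfrac !rmorphM /= -f0E -g0E !map_polyC /=.
rewrite !rmorphM /= -!mulrA [tofrac g * _]mulrCA mulfV // mulr1.
by rewrite mulrCA.
Qed.

End LocalNagata.

Section MaximalSpectrum.
Variables (D : idomainType) (star : set {fraction D} -> set {fraction D}).
Local Notation K := {fraction D}.
Hypothesis star_semistar : semistar star.
Hypothesis finite_character : forall E x, star E x ->
  exists F : set K, [/\ fgmod F, F `<=` E & star F x].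
Hypothesis star_nontrivial : star (range tofrac) <> setT.
Local Notation phi := (@polyfrac D).
Local Notation N := (Nstar star).
Local Notation M := (quasi_maximal star).
Implicit Types (Q : set D) (J : set {fraction {poly K}}).

Let N_mult : mult_closed N. Proof. exact: Nstar_mult_closed. Qed.

Let phi_neq0 s : N s -> phi s != 0.
Proof. by move=> [s0 _]; rewrite polyfrac_eq0. Qed.

Let M_prime Q : M Q -> prime_ideal Q.
Proof. exact: quasi_maximal_prime. Qed.

Let M_ideal Q : M Q -> ideal setT Q.
Proof. by case/M_prime. Qed.

Lemma QXN_fractions Q : M Q -> QXN star Q = fractions phi N (polys Q).
Proof.
by move=> QM; apply: extensionE => //; apply/polys_ideal/M_ideal.
Qed.

Lemma QXN_proper Q :
  M Q -> ideal (DXN star) (QXN star Q) /\ QXN star Q `<` DXN star.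
Proof.
move=> QM; rewrite QXN_fractions //.
have idF := fractions_ideal N_mult phi_neq0 (polys_ideal (M_ideal QM)).
split; first exact: idF.
split; first by case: idF.
move=> /(_ 1)[|f Qf [s Ns]].
  by apply: (sub_fractions N_mult); exists 1; rewrite ?rmorph1.
move/(canRL (divfK (phi_neq0 Ns))); rewrite mul1r => /polyfrac_inj fE.
apply: (quasi_maximal_Nstar star_semistar finite_character QM Qf).
by rewrite fE.
Qed.

(** If a s is in Q[X] with s in N, then a is in Q, because Q[X] is prime and
    does not contain s. *)
Lemma contract_QXN Q : M Q -> contract (QXN star Q) = Q.
Proof.
move=> QM; rewrite QXN_fractions //; apply/seteqP; split=> a.
  move=> [f Qf [s Ns /(canRL (divfK (phi_neq0 Ns)))]].
  rewrite -rmorphM => /polyfrac_inj fE.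
  have [_ _ PQ] := polys_prime (M_prime QM).
  rewrite fE in Qf; case: (PQ _ _ Qf) => [/(polysC _ (M_ideal QM)) //|Qs].
  by case: (quasi_maximal_Nstar star_semistar finite_character QM Qs).
move=> Qa; apply: (sub_fractions N_mult); exists a%:P => //.
exact/(polysC _ (M_ideal QM)).
Qed.

Lemma proper_ideal_sub_QXN J : ideal (DXN star) J -> J `<` DXN star ->
  exists2 Q, M Q & J `<=` QXN star Q.
Proof.
move=> idJ pJ.
have [||Q QM JQ] := disjoint_ideal_sub star_semistar finite_character
  star_nontrivial (J := phi @^-1` J).
- exact: contraction_ideal idJ.
- by move=> h; apply: proper_ideal_disjoint idJ pJ.
exists Q => //; rewrite QXN_fractions // -(fractions_contraction _ _ idJ) //.
by move=> _ [f Jf [s Ns <-]]; exists f; [exact: JQ|exists s].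
Qed.

Lemma maxSpec_DXN : maxSpec (DXN star) = [set QXN star Q | Q in M].
Proof.
apply/seteqP; split=> [J [[idJ pJ] Jmax]|_ [Q QM <-]].
  have [Q QM JQ] := proper_ideal_sub_QXN idJ pJ; exists Q => //.
  by apply: Jmax => //; apply: QXN_proper.
split; first exact: QXN_proper.
move=> J [idJ pJ] QJ; have [P PM JP] := proper_ideal_sub_QXN idJ pJ.
suff PQ : P = Q by apply/seteqP; split=> //; rewrite -PQ.
have [_ Qmax] := QM; apply: Qmax; first by case: PM.
rewrite -(contract_QXN QM) -(contract_QXN PM) => a Qa.
by apply: JP; apply: QJ.
Qed.

Lemma DXN_bigcap : DXN star = \bigcap_(Q in M) nagata (localring Q).
Proof.
apply/seteqP; split=> [_ [f _ [s Ns <-]] Q QM|z zQ].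
  apply: nagata_localring; first exact: M_prime.
  by move=> Qs; apply: quasi_maximal_Nstar QM Qs Ns.
pose J := [set h | exists f, phi h * z = phi f].
have idJ : ideal setT J.
  split=> //; split; first by exists 0; rewrite !rmorph0 mul0r.
    move=> g h [a ga] [b hb]; exists (a + b).
    by rewrite !rmorphD mulrDl ga hb.
  by move=> g h _ [b hb]; exists (g * b); rewrite !rmorphM -mulrA hb.
(* When J meets N, an element of the intersection is a denominator of z;
   otherwise J lies in some Q[X], contradicting membership of z in D_Q(X). *)
have [[s [f sf] Ns]|JN] := pselect (exists2 s, J s & N s).
  exists f => //; exists s => //; rewrite -sf mulrAC mulfV ?mul1r //.
  exact: phi_neq0.
have [|Q QM JQ] := disjoint_ideal_sub star_semistar finite_character
  star_nontrivial idJ; first by move=> h Jh Nh; apply: JN; exists h.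
have [h nQh Jh] := nagata_denominator (M_prime QM) (zQ Q QM).
by case: nQh; apply: JQ.
Qed.

Lemma quasi_maximal_contract : M = [set contract P | P in maxSpec (DXN star)].
Proof.
rewrite maxSpec_DXN; apply/seteqP; split=> [Q QM|_ [_ [Q QM <-] <-]].
  by exists (QXN star Q); [exists Q|exact: contract_QXN].
by rewrite contract_QXN.
Qed.

End MaximalSpectrum.

Theorem proposition3p1 (D : idomainType)
    (star : set {fraction D} -> set {fraction D}) :
  semistar star -> ~ trivial_semistar star ->
  [/\ [/\ Nstar star = Nstar (finite_type star),
          mult_closed (Nstar star) & saturated (Nstar star)],
      Nstar star =
        ~` (\bigcup_(Q in quasi_maximal (finite_type star)) polys Q),
      maxSpec (DXN star) =
        [set QXN star Q | Q in quasi_maximal (finite_type star)],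
      DXN star =
        \bigcap_(Q in quasi_maximal (finite_type star)) nagata (localring Q)
    & quasi_maximal (finite_type star) =
        [set contract M | M in maxSpec (DXN star)]].
Proof.
move=> starS star_nt.
have stS := finite_type_semistar starS.
have stF := @finite_type_finite_character _ _ starS.
have st_nt : finite_type star (range (tofrac : D -> _)) <> setT.
  rewrite (finite_type_fgmod starS (fgmod_range D)) => starD.
  exact/star_nt/trivial_semistar_range.
have NE := Nstar_finite_type starS.
have RE : DXN star = DXN (finite_type star) by rewrite /DXN NE.
have QE : QXN star = QXN (finite_type star) by rewrite /QXN RE.
rewrite RE QE {2 3 4}NE; split.
- by split; [|exact: Nstar_mult_closed|exact: Nstar_saturated].
- exact: Nstar_compl.
- exact: maxSpec_DXN.
- exact: DXN_bigcap.
- exact: quasi_maximal_contract.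
Qed.
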